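(* Let $\alpha\in(0,1)$ and let $0=t_0<t_1<t_2<\cdots$ be time levels with $\tau_k=t_k-t_{k-1}$, $r_1:=0$, $r_k:=\tau_k/\tau_{k-1}$ ($k\ge2$), such that $r_k\ge R_*$ for all $k\ge2$. Then: (a) $A^{(n)}_{n-k-1}>A^{(n)}_{n-k}>0$ for $1\le k\le n-1$ ($n\ge2$); (b) $A^{(n-1)}_{n-1-k}>A^{(n)}_{n-k}$ for $1\le k\le n-1$ ($n\ge2$); (c) $A^{(n-1)}_{n-2-k}-A^{(n-1)}_{n-1-k}>A^{(n)}_{n-k-1}-A^{(n)}_{n-k}$ for $1\le k\le n-2$ ($n\ge3$). Moreover, for every real sequence $(v^k)_{k\ge0}$ and $n\ge2$, $$(\nabla_\tau v^n)\sum_{k=1}^n\hat a^{(n)}_{n-k}\nabla_\tau v^k\ge\frac12\Big[\sum_{j=1}^{n-1}\big(A^{(n)}_{n-j-1}-A^{(n)}_{n-j}\big)\Big(\sum_{\ell=j+1}^n\nabla_\tau v^\ell\Big)^2+A^{(n)}_{n-1}\Big(\sum_{\ell=1}^n\nabla_\tau v^\ell\Big)^2\Big]$$ $$\qquad-\frac12\Big[\sum_{j=1}^{n-2}\big(A^{(n-1)}_{n-j-2}-A^{(n-1)}_{n-1-j}\big)\Big(\sum_{\ell=j+1}^{n-1}\nabla_\tau v^\ell\Big)^2+A^{(n-1)}_{n-2}\Big(\sum_{\ell=1}^{n-1}\nabla_\tau v^\ell\Big)^2\Big].$$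
   Context: Write $\nabla_\tau v^k:=v^k-v^{k-1}$, $\omega_\beta(t):=t^{\beta-1}/\Gamma(\beta)$. For $1\le k\le n$: $a^{(n)}_{n-k}:=\frac1{\tau_k}\int_{t_{k-1}}^{t_k}\omega_{1-\alpha}(t_n-s)\,ds$, $\eta^{(n)}_{n-k}:=\frac{2}{\tau_k}\int_{t_{k-1}}^{t_k}\frac{s-t_{k-1/2}}{\tau_k}\omega_{1-\alpha}(t_n-s)\,ds$, $t_{k-1/2}=(t_k+t_{k-1})/2$. Kernels: $\hat a^{(1)}_0:=a^{(1)}_0$; for $n\ge2$: $\hat a^{(n)}_0:=\frac{1-\alpha}{2-\alpha}a^{(n)}_0+\frac{\eta^{(n)}_1}{r_n(1+r_n)}$, $\hat a^{(n)}_{n-k}:=a^{(n)}_{n-k}-\frac{\eta^{(n)}_{n-k}}{1+r_{k+1}}+\frac{\eta^{(n)}_{n-k+1}}{r_k(1+r_k)}$ ($2\le k\le n-1$), $\hat a^{(n)}_{n-1}:=a^{(n)}_{n-1}-\frac{\eta^{(n)}_{n-1}}{1+r_2}$. Auxiliary kernels: $A^{(n)}_0:=2\hat a^{(n)}_0$ and $A^{(n)}_{n-k}:=\hat a^{(n)}_{n-k}$ for $1\le k\le n-1$. $R_*=\frac19\sqrt[3]{\frac12(189-81\sqrt5)}+\frac13\sqrt[3]{\frac12(7+3\sqrt5)}-\frac13\approx0.4753$, the unique positive root of $3-\frac{1}{z^2(1+z)}=0$. *)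

(* Defs.v *)
From HB Require Import structures.
From mathcomp Require Import all_boot all_order all_algebra.
From mathcomp Require Import all_classical all_reals all_analysis.
Set Implicit Arguments. Unset Strict Implicit. Unset Printing Implicit Defensive.
Import Order.TTheory GRing.Theory Num.Theory.
Local Open Scope classical_set_scope.
Local Open Scope ring_scope.

Section Defs.
Variable R : realType.

Definition Gamma (b : R) : R :=
  Rintegral lebesgue_measure `[0, +oo[ (fun x : R => x `^ (b - 1) * expR (- x)).

Definition omega (b x : R) : R := x `^ (b - 1) / Gamma b.

Definition tau (t : nat -> R) (k : nat) : R := t k - t k.-1.

Definition stepratio (t : nat -> R) (k : nat) : R :=
  if (k <= 1)%N then 0 else tau t k / tau t k.-1.

(* a n k  =  a^{(n)}_{n-k}  (1 <= k <= n) *)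
Definition akern (al : R) (t : nat -> R) (n k : nat) : R :=
  (tau t k)^-1 * Rintegral lebesgue_measure `[t k.-1, t k]
     (fun s => omega (1 - al) (t n - s)).

(* eta n k  =  eta^{(n)}_{n-k}  (1 <= k <= n) *)
Definition etakern (al : R) (t : nat -> R) (n k : nat) : R :=
  2 / tau t k * Rintegral lebesgue_measure `[t k.-1, t k]
     (fun s => (s - (t k + t k.-1) / 2) / tau t k * omega (1 - al) (t n - s)).

(* ahat n k  =  \hat a^{(n)}_{n-k}  (1 <= k <= n) *)
Definition ahat (al : R) (t : nat -> R) (n k : nat) : R :=
  let r := stepratio t in
  if (n <= 1)%N then akern al t 1 1
  else if k == n then
    (1 - al) / (2 - al) * akern al t n n
      + etakern al t n n.-1 / (r n * (1 + r n))
  else if (k <= 1)%N then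
    akern al t n 1 - etakern al t n 1 / (1 + r 2%N)
  else
    akern al t n k - etakern al t n k / (1 + r k.+1)
      + etakern al t n k.-1 / (r k * (1 + r k)).

(* Acap n k  =  A^{(n)}_{n-k}: A^{(n)}_0 = 2 \hat a^{(n)}_0, else \hat a *)
Definition Acap (al : R) (t : nat -> R) (n k : nat) : R :=
  if k == n then 2 * ahat al t n n else ahat al t n k.

Definition Rstar : R :=
  1 / 9 * ((189 - 81 * Num.sqrt 5) / 2) `^ (1 / 3)
  + 1 / 3 * ((7 + 3 * Num.sqrt 5) / 2) `^ (1 / 3) - 1 / 3.

Definition nablav (v : nat -> R) (k : nat) : R := v k - v k.-1.

End Defs.

(* Main.v *)
(* On each interval the kernels are linear functionals of
   [phi s := omega (1 - al) (t n - s)], namely its average (the paper's a)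
   and its first moment (the paper's eta).
   For any increasing convex [phi], slope bounds on [phi] at the nodes give
   [inner phi k <= barrier phi k < inner phi k.+1]; at the common node the
   requirement is [3 r^2 (1 + r) >= 1], which is [r >= R_*].  Taking
   for [phi] the kernel itself yields (a); taking the convex difference
   [omega (t n.-1 - s) - omega (t n - s)] yields (b) and (c).  The singular last interval
   is handled by its exact value [omega(tau) / (1 - al)] together with an upper
   bound on the neighbouring kernel.  Finally, summation by parts and
   [2 d S = S^2 - (S - d)^2 + d^2] turn the energy inequality into an identity
   whose last bracket carries the coefficients of level [n]; (b) and (c) replace
   them by those of level [n - 1]. *)
Require Import Defs.
From HB Require Import structures.
From mathcomp Require Import all_boot all_order all_algebra.
From mathcomp Require Import all_classical all_reals all_analysis.
From mathcomp Require Import measurable_realfun ring lra.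
Set Implicit Arguments. Unset Strict Implicit. Unset Printing Implicit Defensive.
Import Order.TTheory GRing.Theory Num.Theory.
Import numFieldNormedType.Exports.
Local Open Scope classical_set_scope.
Local Open Scope ring_scope.

(** * Averages and first moments of convex functions *)

Section averages.
Variable R : realType.
Notation mu := (@lebesgue_measure R).
Implicit Types (a b c x : R) (f F P p phi h : R -> R).

Lemma integral_derive a b P p : a < b ->
  (forall x, a <= x <= b -> is_derive x 1 P (p x)) ->
  {within `[a, b], continuous p} ->
  (\int[mu]_(x in `[a, b]) (p x)%:E = (P b - P a)%:E)%E.
Proof.
move=> ab dP cp.
have derP x : a <= x <= b -> derivable P x 1 by move=> /dP [].
have /(continuous_within_itvP _ ab)[_ Pa Pb] : {within `[a, b], continuous P}.
  by apply: derivable_within_continuous => x; rewrite in_itv/=; exact: derP.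
rewrite EFinB; apply: continuous_FTC2 => //.
- split => // x; rewrite in_itv/= => /andP[/ltW ? /ltW ?].
  by apply: derP; apply/andP.
- move=> x; rewrite in_itv/= => /andP[/ltW ? /ltW ?].
  by rewrite derive1E; have [|_ ->] := dP x; first exact/andP.
Qed.

Lemma Rintegral_derive a b P p : a < b ->
  (forall x, a <= x <= b -> is_derive x 1 P (p x)) ->
  {within `[a, b], continuous p} ->
  Rintegral mu `[a, b] p = P b - P a.
Proof. by move=> ab dP cp; rewrite /Rintegral (integral_derive ab dP cp). Qed.

Lemma is_derive_cubic (m c0 c1 c2 x : R) :
  is_derive x 1 (fun s => c0 * (s - m) + c1 / 2 * (s - m) ^+ 2 + c2 / 3 * (s - m) ^+ 3)
   (c0 + c1 * (x - m) + c2 * (x - m) ^+ 2).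
Proof.
by apply: is_derive_eq; rewrite /GRing.scale /=; field.
Qed.

Lemma is_derive_powR_sub (c b x : R) : x < c ->
  is_derive x 1 (fun s => (c - s) `^ b) (- (b * (c - x) `^ (b - 1))).
Proof.
move=> xc.
have H : is_derive (c - x) 1 (fun u : R => u `^ b) (b * (c - x) `^ (b - 1)).
  by apply: is_derive1_powR; rewrite subr_gt0.
have G : is_derive x 1 (fun s : R => c - s) (- 1).
  by apply: is_derive_eq; ring.
apply: is_derive_eq.
  exact: (@is_derive1_comp R (fun u : R => u `^ b) (fun s : R => c - s) x _ _ H G).
by rewrite mulrN1.
Qed.

Lemma within_integrable a b f : {within `[a, b], continuous f} ->
  mu.-integrable `[a, b] (EFin \o f).
Proof. by move=> cf; apply: continuous_compact_integrable => //; exact: segment_compact. Qed.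

Lemma continuous_quad (m c0 c1 c2 : R) :
  continuous (fun s : R => c0 + c1 * (s - m) + c2 * (s - m) ^+ 2).
Proof.
move=> x; apply/differentiable_continuous/derivable1_diffP.
exact: ex_derive.
Qed.

(** Centring at the midpoint makes the linear term odd, so [c1] drops out. In the comparison lemmas
    below it is therefore a free parameter, chosen to fit the pointwise bound. *)
Lemma Rintegral_quad a b (c0 c1 c2 : R) : a < b ->
  Rintegral mu `[a, b]
    (fun s => c0 + c1 * (s - (a + b) / 2) + c2 * (s - (a + b) / 2) ^+ 2) =
  (b - a) * (c0 + c2 * (b - a) ^+ 2 / 12).
Proof.
move=> ab; pose P := fun s : R => c0 * (s - (a + b) / 2)
  + c1 / 2 * (s - (a + b) / 2) ^+ 2 + c2 / 3 * (s - (a + b) / 2) ^+ 3.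
transitivity (P b - P a); last by rewrite /P; field.
apply: Rintegral_derive => // [x _|]; first exact: is_derive_cubic.
by apply: continuous_subspaceT; exact: continuous_quad.
Qed.

Definition avg a b phi : R := (b - a)^-1 * Rintegral mu `[a, b] phi.

(** The midpoint is written [(b + a) / 2] so that [mom (t k.-1) (t k)] applied to the kernel is
    convertible to [etakern]. *)
Definition mom a b phi : R := 2 / (b - a) *
  Rintegral mu `[a, b] (fun s => (s - (b + a) / 2) / (b - a) * phi s).

Lemma within_continuousM a b f phi : continuous f -> {within `[a, b], continuous phi} ->
  {within `[a, b], continuous (fun s => f s * phi s)}.
Proof.
move=> cf cphi x.
apply: (@continuousM R (subspace `[a, b])); last exact: cphi.
by apply: continuous_subspaceT.
Qed.

(** The affine function equal to [u - v] at [a] and [u + v] at [b]. Its product with [phi] has mean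
    [u * avg a b phi + v * mom a b phi]. *)
Definition weight a b (u v s : R) := u + v * (2 * (s - (a + b) / 2) / (b - a)).

Lemma continuous_weight a b u v : continuous (weight a b u v).
Proof.
move=> x; apply/differentiable_continuous/derivable1_diffP.
exact: ex_derive.
Qed.

Lemma avg_momE a b phi (u v : R) : a < b -> {within `[a, b], continuous phi} ->
  u * avg a b phi + v * mom a b phi =
  (b - a)^-1 * Rintegral mu `[a, b] (fun s => weight a b u v s * phi s).
Proof.
move=> ab cphi.
have c1 : {within `[a, b], continuous (fun s => (s - (b + a) / 2) / (b - a) * phi s)}.
  apply: within_continuousM => // x.
  apply/differentiable_continuous/derivable1_diffP.
  exact: ex_derive.
have -> : Rintegral mu `[a, b] (fun s => weight a b u v s * phi s) =
  Rintegral mu `[a, b] (fun s => u * phi s +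
     v * 2 * ((s - (b + a) / 2) / (b - a) * phi s)).
  by apply: eq_Rintegral => s _; rewrite /weight; field; rewrite subr_eq0 gt_eqF.
have i0 := within_integrable cphi.
have i1 := within_integrable c1.
rewrite RintegralD //; last 2 first.
- by apply: within_integrable; apply: within_continuousM cphi => x; exact: cst_continuous.
- by apply: within_integrable; apply: within_continuousM c1 => x; exact: cst_continuous.
rewrite !RintegralZl // /avg /mom; field; by rewrite subr_eq0 gt_eqF.
Qed.

Lemma avg_mom_ge a b phi (u v c0 c1 c2 : R) : a < b ->
  {within `[a, b], continuous phi} ->
  (forall s, a <= s <= b ->
     c0 + c1 * (s - (a + b) / 2) + c2 * (s - (a + b) / 2) ^+ 2
       <= weight a b u v s * phi s) ->
  c0 + c2 * (b - a) ^+ 2 / 12 <= u * avg a b phi + v * mom a b phi.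
Proof.
move=> ab cphi H; rewrite avg_momE // ler_pdivlMl ?subr_gt0 // -(Rintegral_quad c0 c1 c2 ab).
apply: le_Rintegral => //.
- apply: within_integrable; apply: continuous_subspaceT.
  exact: continuous_quad.
- apply: within_integrable; apply: within_continuousM => //.
  exact: continuous_weight.
Qed.

Lemma avg_mom_le a b phi (u v c0 c1 c2 : R) : a < b ->
  {within `[a, b], continuous phi} ->
  (forall s, a <= s <= b ->
     weight a b u v s * phi s <=
     c0 + c1 * (s - (a + b) / 2) + c2 * (s - (a + b) / 2) ^+ 2) ->
  u * avg a b phi + v * mom a b phi <= c0 + c2 * (b - a) ^+ 2 / 12.
Proof.
move=> ab cphi H.
suff : - c0 + - c2 * (b - a) ^+ 2 / 12 <= - u * avg a b phi + - v * mom a b phi by lra.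
apply: (@avg_mom_ge _ _ _ _ _ _ (- c1)) => // s /H.
by rewrite /weight; lra.
Qed.

Lemma avgB a b f phi : {within `[a, b], continuous f} -> {within `[a, b], continuous phi} ->
  avg a b (fun s => f s - phi s) = avg a b f - avg a b phi.
Proof.
by move=> cf cphi; rewrite /avg RintegralB ?mulrBr //; exact: within_integrable.
Qed.

Lemma momB a b f phi : a < b ->
  {within `[a, b], continuous f} -> {within `[a, b], continuous phi} ->
  mom a b (fun s => f s - phi s) = mom a b f - mom a b phi.
Proof.
move=> ab cf cphi; rewrite /mom.
have cw : continuous (fun s => (s - (b + a) / 2) / (b - a)).
  by move=> x; apply/differentiable_continuous/derivable1_diffP; exact: ex_derive.
under eq_Rintegral do rewrite mulrBr.
by rewrite RintegralB ?mulrBr //; apply: within_integrable; exact: within_continuousM.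
Qed.

(** Convexity stated as a two-sided subgradient inequality, with positivity of function and slope.
    The two bounds together force [h] to be nondecreasing, so the estimates below never
    differentiate [phi]. *)
Record slopes phi h A T : Prop := Slopes {
  slopes_cont : {within `[A, T], continuous phi};
  slopes_bound : forall x y, A <= x -> x <= y -> y <= T ->
    h x * (y - x) <= phi y - phi x /\ phi y - phi x <= h y * (y - x);
  slopes_gt0 : forall x, A <= x <= T -> 0 < phi x /\ 0 < h x }.

Lemma slopesW phi h A T A' T' : A <= A' -> T' <= T -> slopes phi h A T -> slopes phi h A' T'.
Proof.
move=> hA hT [c b p]; split.
- apply: continuous_subspaceW c => x /=; rewrite !in_itv /=; lra.
- by move=> x y *; apply: b; lra.
- by move=> x *; apply: p; lra.
Qed.

Lemma slopes_derive phi h A T :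
  (forall x, A <= x <= T -> is_derive x 1 phi (h x)) ->
  (forall x y, A <= x -> x <= y -> y <= T -> h x <= h y) ->
  (forall x, A <= x <= T -> 0 < phi x /\ 0 < h x) -> slopes phi h A T.
Proof.
move=> dphi mh p; split => //.
  by apply: derivable_within_continuous => x; rewrite in_itv /= => /dphi [].
move=> x y Ax xy yT.
have [z|| z] := @MVT_segment R phi h x y xy.
- by rewrite in_itv /= => zxy; apply: dphi; lra.
- apply: derivable_within_continuous => z; rewrite in_itv /= => zxy.
  by have [|] := dphi z; first lra.
- rewrite in_itv /= => zxy ->.
  by split; apply: ler_wpM2r; rewrite ?mh //; lra.
Qed.

(** * Bounds on averages and moments from endpoint slopes *)

Section slopes.
Variables (phi h : R -> R) (a b : R).
Hypothesis ab : a < b.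
Hypothesis S : slopes phi h a b.
Let ba : 0 < b - a. Proof. by rewrite subr_gt0. Qed.
Let ba0 : b - a != 0. Proof. exact: lt0r_neq0. Qed.

Lemma slopes_nondecr x y : a <= x -> x <= y -> y <= b -> phi x <= phi y.
Proof.
move=> ax xy yb; have [+ _] := slopes_bound S ax xy yb.
rewrite -subr_ge0 -(subr_ge0 (phi x)) => H.
suff : 0 <= h x * (y - x) by lra.
by apply: mulr_ge0; [apply/ltW; apply: (slopes_gt0 S _).2; lra|lra].
Qed.

(** The moment is unchanged when the constant [phi m] is subtracted, [m] being the midpoint, and
    [(s - m) * (phi s - phi m)] is nonnegative because [phi] increases. *)
Lemma mom_ge0 : 0 <= mom a b phi.
Proof.
suff : 0 + 0 * (b - a) ^+ 2 / 12 <= 0 * avg a b phi + 1 * mom a b phi by lra.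
have [m mE] : exists m, m = (a + b) / 2 by exists ((a + b) / 2).
apply: (@avg_mom_ge _ _ _ _ _ _ (2 * phi m / (b - a))) => //; first exact: slopes_cont S.
move=> s sab; rewrite /weight -mE -subr_ge0.
have -> : (0 + 1 * (2 * (s - m) / (b - a))) * phi s -
   (0 + 2 * phi m / (b - a) * (s - m) + 0 * (s - m) ^+ 2) =
   2 / (b - a) * ((s - m) * (phi s - phi m)) by field.
apply: mulr_ge0; first by apply: divr_ge0; lra.
have [sm|ms] := lerP s m.
  have : phi s <= phi m by apply: slopes_nondecr; lra.
  by move=> ?; rewrite -mulrNN; apply: mulr_ge0; lra.
have : phi m <= phi s by apply: slopes_nondecr; lra.
by move=> ?; apply: mulr_ge0; lra.
Qed.

(** On both sides of the midpoint [m], [(s - m) * (phi s - phi m)] is at most [h b * (s - m) ^+ 2],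
    since [h b] is the largest slope. Integrating this square gives the constant 1/6. *)
Lemma mom_le : mom a b phi <= h b * (b - a) / 6.
Proof.
have [m mE] : exists m, m = (a + b) / 2 by exists ((a + b) / 2).
pose k := 2 * h b / (b - a).
suff : 0 * avg a b phi + 1 * mom a b phi <= 0 + k * (b - a) ^+ 2 / 12.
  have -> : 0 + k * (b - a) ^+ 2 / 12 = h b * (b - a) / 6 by rewrite /k; field.
  lra.
apply: (@avg_mom_le _ _ _ _ _ _ (2 * phi m / (b - a))) => //; first exact: slopes_cont S.
move=> s sab; rewrite /weight -mE -subr_ge0.
have -> : 0 + 2 * phi m / (b - a) * (s - m) + k * (s - m) ^+ 2 -
   (0 + 1 * (2 * (s - m) / (b - a))) * phi s =
   2 / (b - a) * ((s - m) * (h b * (s - m) - (phi s - phi m))) by rewrite /k; field.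
have hmono x y : a <= x -> x < y -> y <= b -> h x <= h y.
  move=> ax xy yb; have [H1 H2] := slopes_bound S ax (ltW xy) yb.
  by move: (le_trans H1 H2); rewrite ler_pM2r // subr_gt0.
have hle x : a <= x -> x <= b -> h x <= h b.
  by move=> ax; rewrite le_eqVlt => /predU1P[->//|xb]; exact: hmono.
apply: mulr_ge0; first by apply: divr_ge0; lra.
have [sm|ms] := lerP s m.
  have [|||_ H] := slopes_bound S (x := s) (y := m); [lra|lra|lra|].
  rewrite -mulrNN; apply: mulr_ge0; first lra.
  have : h m * (m - s) <= h b * (m - s).
    by apply: ler_wpM2r; [lra | apply: hle; lra].
  by lra.
have [|||_ H] := slopes_bound S (x := m) (y := s); [lra|lra|lra|].
apply: mulr_ge0; first lra.
have : h s * (s - m) <= h b * (s - m).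
  by apply: ler_wpM2r; [lra | apply: hle; lra].
by lra.
Qed.

Lemma avg_le : avg a b phi <= phi b - h a * (b - a) / 2.
Proof.
suff : 1 * avg a b phi + 0 * mom a b phi <=
  (phi b - h a * (b - a) / 2) + 0 * (b - a) ^+ 2 / 12 by lra.
apply: (@avg_mom_le _ _ _ _ _ _ (h a)) => //; first exact: slopes_cont S.
move=> s sab; rewrite /weight.
have [|||H _] := slopes_bound S (x := s) (y := b); [lra|lra|lra|].
have : h a * (b - s) <= h s * (b - s).
  apply: ler_wpM2r; first lra.
  have [|||H1 H2] := slopes_bound S (x := a) (y := s); [lra|lra|lra|].
  have [->//|sa] := eqVneq s a.
  have as_ : a < s by rewrite lt_neqAle eq_sym sa; lra.
  by move: (le_trans H1 H2); rewrite ler_pM2r // subr_gt0.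
lra.
Qed.

(** The combination has the weight [2 * (b - s) / (b - a)], nonnegative and zero at [b]. Replacing
    [phi] by its supporting line at [a] leaves an explicit quadratic. *)
Lemma avg_sub_mom_ge : phi a + h a * (b - a) / 3 <= avg a b phi - mom a b phi.
Proof.
have [m mE] : exists m, m = (a + b) / 2 by exists ((a + b) / 2).
suff : phi a + h a * (b - a) / 2 + (- 2 * h a / (b - a)) * (b - a) ^+ 2 / 12 <=
    1 * avg a b phi + -1 * mom a b phi.
  have -> : phi a + h a * (b - a) / 2 + (- 2 * h a / (b - a)) * (b - a) ^+ 2 / 12 =
    phi a + h a * (b - a) / 3 by field.
  lra.
apply: (@avg_mom_ge _ _ _ _ _ _
  (h a - 2 / (b - a) * (phi a + h a * (b - a) / 2))) => //; first exact: slopes_cont S.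
move=> s sab; rewrite /weight -mE -subr_ge0.
set X := (X in 0 <= X).
have -> : X = 2 / (b - a) * ((b - s) * (phi s - phi a - h a * (s - a))).
  by rewrite /X mE; field.
have [|||H _] := slopes_bound S (x := a) (y := s); [lra|lra|lra|].
apply: mulr_ge0; first by apply: divr_ge0; lra.
by apply: mulr_ge0; lra.
Qed.
End slopes.
End averages.

(** * Improper integrals of powers *)

Section improper_integrals.
Variable R : realType.
Notation mu := (@lebesgue_measure R).
Implicit Types (a b c x : R) (f F P p phi h : R -> R).

(** Differentiability is asked only in the open interval, so [p] may blow up at an endpoint. The
    closed intervals shrunk by [e n] exhaust the open one, and monotone convergence passes to the
    limit. *)
Lemma ge0_integral_derive_oo a b P p : a < b ->
  (forall x, a < x < b -> is_derive x 1 P (p x)) ->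
  (forall x, a < x < b -> {for x, continuous p}) ->
  (forall x, a < x < b -> 0 <= p x) ->
  {within `[a, b], continuous P} ->
  (\int[mu]_(x in `[a, b]) (p x)%:E = (P b - P a)%:E)%E.
Proof.
move=> ab dP cp p0 /(continuous_within_itvP _ ab)[_ Pa Pb].
have mp : measurable_fun `]a, b[ p.
  apply: open_continuous_measurable_fun => // x.
  by rewrite inE /= in_itv /=; exact: cp.
rewrite integral_itv_bndoo; last exact/measurable_EFinP.
(* The factor 1/3 keeps [a + e n < b - e n] already for [n = 0]. *)
pose e n : R := (b - a) / 3 * (n.+1%:R)^-1.
have e_gt0 n : 0 < e n by rewrite mulr_gt0 ?invr_gt0 //; lra.
have e_le n : e n <= (b - a) / 3.
  by rewrite ler_piMr ?invf_le1 ?ler1n //; lra.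
have e_cvg0 : e n @[n --> \oo] --> (0 : R).
  rewrite -[X in _ --> X](mulr0 ((b - a) / 3)).
  by apply: cvgM; [exact: cvg_cst|exact: cvg_harmonic].
have e_nincr m n : (m <= n)%N -> e n <= e m.
  by move=> mn; rewrite ler_wpM2l ?lef_pV2 ?posrE ?ler_nat //; lra.
pose I n : set R := `[a + e n, b - e n]%classic.
have IE : (`]a, b[ = \bigcup_n I n)%classic.
  apply/seteqP; split => x /=.
    rewrite in_itv /= => axb.
    pose d := Num.min (x - a) (b - x).
    have d0 : 0 < d by rewrite lt_min; lra.
    have [N _ HN] : \forall n \near \oo, e n < d.
      by have /cvgr0Pnorm_lt/(_ _ d0) := e_cvg0; apply: filterS => n; rewrite gtr0_norm.
    exists N => //; rewrite /I /= in_itv /=.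
    by have := HN N (leqnn _); rewrite /= lt_min; lra.
  by move=> [n _]; rewrite /I /= !in_itv /=; have := e_gt0 n; lra.
have Iab n x : I n x -> a < x < b.
  by rewrite /I /= in_itv /=; have := e_gt0 n; lra.
have intI n : (\int[mu]_(x in I n) (p x)%:E = (P (b - e n) - P (a + e n))%:E)%E.
  apply: integral_derive.
  - by have := e_le n; lra.
  - by move=> x xI; apply: dP; have := e_gt0 n; lra.
  - apply: continuous_in_subspaceT => x; rewrite inE => /Iab; exact: cp.
have c1 : ((fun n => \int[mu]_(x in I n) (p x)%:E) @ \oo -->
    \int[mu]_(x in \bigcup_n I n) (p x)%:E)%E.
  apply: ge0_nondecreasing_set_cvg_integral => //.
  - move=> m n mn; rewrite subsetEset => x; rewrite /I /= !in_itv /=.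
    by have := e_nincr _ _ mn; lra.
  - by move=> n; exact: measurable_itv.
  - move=> n; apply/measurable_EFinP; apply: measurable_funS mp => // x /Iab /=.
    by rewrite in_itv.
  - by move=> n x /Iab /p0; rewrite lee_fin.
move: c1; rewrite IE; under eq_fun do rewrite intI.
move=> c1; apply: (cvg_unique _ c1) => //.
apply: cvg_EFin; first exact: nearW.
apply: cvgB.
- apply: ((cvg_at_leftP _ _ _).1 Pb (fun n => b - e n)); split.
    by move=> n; have := e_gt0 n; lra.
  by rewrite -[X in _ --> X]subr0; apply: cvgB => //; exact: cvg_cst.
- apply: ((cvg_at_rightP _ _ _).1 Pa (fun n => a + e n)); split.
    by move=> n; have := e_gt0 n; lra.
  by rewrite -[X in _ --> X]addr0; apply: cvgD => //; exact: cvg_cst.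
Qed.

Lemma continuous_powR (r x : R) : 0 < x -> {for x, continuous (fun u : R => u `^ r)}.
Proof.
move=> x0; apply/differentiable_continuous/derivable1_diffP.
by have [] := is_derive1_powR r x0.
Qed.

Lemma within_continuous_powR (r b : R) : 0 < b -> 0 < r ->
  {within `[0, b], continuous (fun u : R => u `^ r)}.
Proof.
move=> b0 r0; apply/(continuous_within_itvP _ b0); split.
- by move=> x; rewrite in_itv /= => /andP[x0 _]; exact: continuous_powR.
- by rewrite powR0 ?gt_eqF //; exact: powR_cvg0.
- apply: cvg_at_left_filter; exact: continuous_powR.
Qed.

Lemma integral_powR0 (r b : R) : 0 < r -> 0 < b ->
  (\int[mu]_(x in `[0%R, b]) (x `^ (r - 1))%:E = (b `^ r / r)%:E)%E.
Proof.
move=> r0 b0.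
pose P (x : R) := r^-1 * x `^ r.
transitivity (P b - P 0)%:E; last by rewrite /P powR0 ?gt_eqF // mulr0 subr0 mulrC.
apply: ge0_integral_derive_oo => //.
- move=> x /andP[x0 _]; have := is_derive1_powR r x0 => H.
  by apply: is_derive_eq; rewrite /GRing.scale /= mulKf // gt_eqF.
- by move=> x /andP[x0 _]; exact: continuous_powR.
- by move=> x _; exact: powR_ge0.
- by apply: within_continuousM; [exact: cst_continuous | exact: within_continuous_powR].
Qed.

Lemma Rintegral_powR_sub (r g a b : R) : 0 < r -> 0 < g -> a < b ->
  Rintegral mu `[a, b] (fun s => (b - s) `^ (r - 1) / g) = (b - a) `^ r / (r * g).
Proof.
move=> r0 g0 ab; pose P (x : R) := - (r * g)^-1 * (b - x) `^ r.
transitivity (P b - P a); last by rewrite /P subrr powR0 ?gt_eqF //; lra.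
rewrite -[RHS]/(fine (P b - P a)%:E); congr fine.
apply: ge0_integral_derive_oo => //.
- move=> x /andP[_ xb]; have := is_derive_powR_sub r xb => H.
  by apply: is_derive_eq; rewrite /GRing.scale /=; field; rewrite !gt_eqF.
- move=> x /andP[_ xb].
  have H := is_derive_powR_sub (r - 1) xb.
  by apply/differentiable_continuous/derivable1_diffP; exact: ex_derive.
- by move=> x _; rewrite divr_ge0 ?powR_ge0 // ltW.
- apply: within_continuousM; first exact: cst_continuous.
  have ba : 0 < b - a by lra.
  have /(continuous_within_itvP _ ba)[H0 H1 H2] := within_continuous_powR ba r0.
  apply/(continuous_within_itvP _ ab); split.
  + move=> x; rewrite in_itv /= => /andP[_ xb].
    have [+ _] := is_derive_powR_sub r xb.
    by move/derivable1_diffP/differentiable_continuous.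
  + apply: cvg_at_right_filter.
    have [+ _] := is_derive_powR_sub r ab.
    by move/derivable1_diffP/differentiable_continuous.
  (* At the singular end [b] only a one-sided limit exists: sequences [u n] tending to [b] from the
     left are turned into [b - u n] tending to 0 from the right. *)
  + rewrite subrr powR0 ?gt_eqF //.
    apply/cvg_at_leftP => u [ub uc].
    apply: ((cvg_at_rightP _ _ _).1 (powR_cvg0 r0) (fun n => b - u n)); split.
      by move=> n; have := ub n; lra.
    by rewrite -[X in _ --> X](subrr b); apply: cvgB => //; exact: cvg_cst.
Qed.

(** [Rintegral] is the [fine] part of an extended integral, and [fine] sends infinity to 0.
    Positivity thus needs finiteness as well as a positive lower bound. *)
Lemma Gamma_gt0 (r : R) : 0 < r -> r <= 1 -> 0 < Gamma r.
Proof.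
move=> r0 r1; rewrite /Gamma /Rintegral.
pose g (x : R) := x `^ (r - 1) * expR (- x).
have g0 x : (0 <= (g x)%:E)%E by rewrite lee_fin mulr_ge0 ?powR_ge0 ?expR_ge0.
have mE : measurable_fun setT (fun x : R => expR (- x)).
  by apply: measurableT_comp => //; exact: measurable_funN.
have mg : measurable_fun setT g.
  by apply: measurable_funM mE.
have intE : (\int[mu]_(x in `[0%R, +oo[) (expR (- x))%:E = 1)%E.
  rewrite (@ge0_continuous_FTC2y _ (fun x => expR (- x)) (fun x => - expR (- x)) 0 0).
  - by rewrite oppr0 expR0 -EFinB opprK add0r.
  - by move=> x _; exact: expR_ge0.
  - apply: continuous_subspaceT => x.
    apply/differentiable_continuous/derivable1_diffP; exact: ex_derive.
  - by rewrite -[X in _ --> X]oppr0; apply: cvgN; exact: cvgr_expR.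
  - by move=> x _; exact: ex_derive.
  - apply: cvg_at_right_filter.
    have cE : continuous (fun x : R => - expR (- x)).
      move=> x; apply/differentiable_continuous/derivable1_diffP; exact: ex_derive.
    exact: cE.
  - by move=> x _; rewrite derive1E derive_val; ring.
have sub A B : measurable A -> measurable B -> A `<=` B ->
   (\int[mu]_(x in A) (g x)%:E <= \int[mu]_(x in B) (g x)%:E)%E.
  move=> mA mB AB; apply: ge0_subset_integral => //.
  by apply/measurable_EFinP; apply: measurable_funS mg.
apply: fine_gt0; apply/andP; split.
(* A lower bound of the integrand on [1, 2], where the power is at least [x^-1 >= 1/2]. *)
- pose c : R := 2^-1 * expR (-2).
  have c0 : 0 < c by rewrite mulr_gt0 ?expR_gt0.
  apply: (@lt_le_trans _ _ (\int[mu]_(x in `[1%R, 2%R]) (cst c%:E x))%E).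
    rewrite integral_cst //= lebesgue_measure_itv /= lte_fin ltr1n.
    by rewrite -EFinD -EFinM lte_fin mulr_gt0 //; lra.
  apply: (@le_trans _ _ (\int[mu]_(x in `[1%R, 2%R]) (g x)%:E)%E); last first.
    apply: sub => // x /=; rewrite !in_itv /=; lra.
  apply: ge0_le_integral => //=.
  + by move=> x _; rewrite lee_fin ltW.
  + by apply/measurable_EFinP; apply: measurable_funS mg.
  + move=> x; rewrite in_itv /= => x12; rewrite lee_fin /c /g.
    apply: ler_pM => //; rewrite ?expR_ge0 ?ler_expR //; last lra.
    apply: (@le_trans _ _ (x `^ (-1))).
      by rewrite powR_inv1 ?lef_pV2 ?posrE //; lra.
    by apply: ler_powR; lra.
(* Finiteness by splitting at 1: below 1 the exponential is at most 1, above 1 the power is at most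
   1 because [r <= 1]. *)
- have -> : `[0, +oo[%classic = `[0, 1] `|` `]1, +oo[ :> set R.
    apply/seteqP; split => x /=; rewrite !in_itv /= !andbT; last lra.
    by move=> x0; have [|] := lerP x 1; lra.
  rewrite ge0_integral_setU //=; last 3 first.
  + by apply/measurable_EFinP; apply: measurable_funS mg.
  + by move=> x _; exact: g0.
  + by apply/disj_setPS => x /= []; rewrite !in_itv /=; lra.
  apply: (@le_lt_trans _ _ (\int[mu]_(x in `[0%R, 1%R]) (x `^ (r - 1))%:E +
    \int[mu]_(x in `[0%R, +oo[) (expR (- x))%:E)%E); last first.
    by rewrite integral_powR0 // intE -EFinD ltry.
  apply: leeD.
  + apply: ge0_le_integral => //=.
    * by move=> x _; exact: g0.
    * by apply/measurable_EFinP; apply: measurable_funS mg.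
    * by apply/measurable_EFinP; apply: measurable_funS (measurable_powR (r - 1)).
    * move=> x; rewrite in_itv /= => x01; rewrite lee_fin ler_piMr ?powR_ge0 //.
      by rewrite expR_le1; lra.
  + apply: (@le_trans _ _ (\int[mu]_(x in `]1%R, +oo[) (expR (- x))%:E)%E).
      apply: ge0_le_integral => //=.
      * by move=> x _; exact: g0.
      * by apply/measurable_EFinP; apply: measurable_funS mg.
      * by apply/measurable_EFinP; apply: measurable_funS mE.
      * move=> x; rewrite in_itv /= andbT => x1; rewrite lee_fin ler_piMl ?expR_ge0 //.
        by rewrite -[leRHS](powRr0 x); apply: ler_powR; lra.
    apply: ge0_subset_integral => //=.
    * by apply/measurable_EFinP; apply: measurable_funS mE.
    * by move=> x /=; rewrite !in_itv /=; lra.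
Qed.

End improper_integrals.

(** * Power kernels and the ratio bound *)

Section power_kernels.
Variable R : realType.
Notation mu := (@lebesgue_measure R).
Implicit Types (a b c x : R) (f F P p phi h : R -> R).

Lemma powR_lt_decr (p x y : R) : p < 0 -> 0 < x -> x < y -> y `^ p < x `^ p.
Proof.
move=> p0 x0 xy; rewrite -[p]opprK !(powRN _ (- p)).
rewrite ltf_pV2 ?posrE ?powR_gt0 //; last lra.
by apply: gt0_ltr_powR => //; rewrite ?nnegrE; lra.
Qed.

Lemma powR_le_decr (p x y : R) : p < 0 -> 0 < x -> x <= y -> y `^ p <= x `^ p.
Proof.
move=> p0 x0; rewrite le_eqVlt => /predU1P[->//|xy].
exact/ltW/powR_lt_decr.
Qed.

Lemma powRS (p x : R) : 0 < x -> x `^ (p + 1) = x * x `^ p.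
Proof. by move=> x0; rewrite addrC powRD ?(gt_eqF x0) ?implybT // powRr1 // ltW. Qed.

Lemma slopes_powR_sub (p g c A T : R) : p < 0 -> 0 < g -> T < c ->
  slopes (fun s => (c - s) `^ p / g) (fun s => - p * (c - s) `^ (p - 1) / g) A T.
Proof.
move=> p0 g0 Tc; apply: slopes_derive.
- move=> x xAT; have xc : x < c by lra.
  have H r := is_derive_powR_sub r xc.
  by apply: is_derive_eq; rewrite /GRing.scale /=; ring.
- move=> x y Ax xy yT; rewrite ler_pM2r ?invr_gt0 // ler_pM2l ?oppr_gt0 //.
  by apply: powR_le_decr; lra.
- move=> x xAT; split; first by rewrite divr_gt0 ?powR_gt0 //; lra.
  by rewrite divr_gt0 ?mulr_gt0 ?powR_gt0 ?oppr_gt0 //; lra.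
Qed.

(** With [q = p - 1] this is the monotonicity of the slope of a difference of two shifted kernels,
    hence the convexity of that difference. *)
Lemma powR_sub_diff_nondecr (q c d x y : R) : q < 0 -> c <= d -> x <= y -> y < c ->
  (c - x) `^ q - (d - x) `^ q <= (c - y) `^ q - (d - y) `^ q.
Proof.
move=> q0 cd xy yc.
pose psi (s : R) := (c - s) `^ q - (d - s) `^ q.
pose dpsi (s : R) := - q * ((c - s) `^ (q - 1) - (d - s) `^ (q - 1)).
have D z : z < c -> is_derive z 1 psi (dpsi z).
  move=> zc; have zd : z < d by lra.
  have H r := is_derive_powR_sub r zc.
  have K r := is_derive_powR_sub r zd.
  by apply: is_derive_eq; rewrite /dpsi; ring.
rewrite -subr_ge0 -/(psi x) -/(psi y).
have [z||z] := @MVT_segment R psi dpsi x y xy.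
- by rewrite in_itv /= => zxy; apply: D; lra.
- apply: derivable_within_continuous => z; rewrite in_itv /= => zxy.
  by have [|] := D z; first lra.
- rewrite in_itv /= => zxy ->; apply: mulr_ge0; last lra.
  apply: mulr_ge0; first lra.
  by rewrite subr_ge0; apply: powR_le_decr; lra.
Qed.

Lemma slopes_powR_sub_diff (p g c d A T : R) : p < 0 -> 0 < g -> T < c -> c < d ->
  slopes (fun s => (c - s) `^ p / g - (d - s) `^ p / g)
    (fun s => - p * ((c - s) `^ (p - 1) - (d - s) `^ (p - 1)) / g) A T.
Proof.
move=> p0 g0 Tc cd; apply: slopes_derive.
- move=> x xAT; have xc : x < c by lra.
  have xd : x < d by lra.
  have H r := is_derive_powR_sub r xc.
  have K r := is_derive_powR_sub r xd.
  by apply: is_derive_eq; rewrite /GRing.scale /=; ring.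
- move=> x y Ax xy yT; rewrite ler_pM2r ?invr_gt0 // ler_pM2l ?oppr_gt0 //.
  by apply: powR_sub_diff_nondecr; lra.
- move=> x xAT; split.
    by rewrite subr_gt0 ltr_pM2r ?invr_gt0 //; apply: powR_lt_decr; lra.
  rewrite divr_gt0 // mulr_gt0 ?oppr_gt0 // subr_gt0.
  by apply: powR_lt_decr; lra.
Qed.

(** * The kernel [omega] on regular and singular intervals *)

Section omega.
Variable al : R.
Notation w := (omega (1 - al)).
Local Notation G := (Gamma (1 - al)).
Local Notation e := (1 - al - 1).

Lemma omega_gt0 x : 0 < al -> al < 1 -> 0 < x -> 0 < w x.
Proof. by move=> al0 al1 x0; rewrite divr_gt0 ?powR_gt0 ?Gamma_gt0 //; lra. Qed.

Lemma omega_decr x y : 0 < al -> al < 1 -> 0 < x -> x < y -> w y < w x.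
Proof.
move=> al0 al1 x0 xy; rewrite ltr_pM2r ?invr_gt0 ?Gamma_gt0 //; try lra.
by apply: powR_lt_decr; lra.
Qed.

Lemma slopes_omega c A T : 0 < al -> al < 1 -> T < c ->
  slopes (fun s => w (c - s)) (fun s => - e * (c - s) `^ (e - 1) / G) A T.
Proof. by move=> al0 al1 Tc; apply: slopes_powR_sub; rewrite ?Gamma_gt0 //; lra. Qed.

Lemma slopes_omega_diff c d A T : 0 < al -> al < 1 -> T < c -> c < d ->
  slopes (fun s => w (c - s) - w (d - s))
   (fun s => - e * ((c - s) `^ (e - 1) - (d - s) `^ (e - 1)) / G) A T.
Proof.
by move=> al0 al1 Tc cd; apply: slopes_powR_sub_diff; rewrite ?Gamma_gt0 //; lra.
Qed.

Lemma avg_omega a b : 0 < al -> al < 1 -> a < b ->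
  avg a b (fun s => w (b - s)) = w (b - a) / (1 - al).
Proof.
move=> al0 al1 ab; have G0 : 0 < G by apply: Gamma_gt0; lra.
rewrite /avg Rintegral_powR_sub //; last lra.
rewrite -[1 - al in X in X / _](subrK 1) powRS; last lra.
rewrite /omega; field; lra.
Qed.

(* The primitive comes from integrating by parts once and then bounding
   [(b - s) / (b - a)] by [(c - s) / (c - a)]. *)
Lemma avg_mom_omega_le a b c : 0 < al -> al < 1 -> a < b -> b < c ->
  avg a b (fun s => w (c - s)) - (b - a) / (c - a) * mom a b (fun s => w (c - s))
  <= 2 / (2 - al) * w (c - a).
Proof.
move=> al0 al1 ab bc; have G0 : 0 < G by apply: Gamma_gt0; lra.
have ba : 0 < b - a by lra.
have ca : 0 < c - a by lra.
pose P (s : R) := (- (b - s) * (c - s) `^ (e + 1) / (c - a)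
  - al * (b - a) / ((c - a) ^+ 2 * (2 - al)) * (c - s) `^ (e + 1 + 1)) / G.
pose p (s : R) := ((c - s) `^ (e + 1) / (c - a)
  + (1 - al) * (b - s) * (c - s) `^ e / (c - a)
  + al * (b - a) / (c - a) ^+ 2 * (c - s) `^ (e + 1)) / G.
have cw : {within `[a, b], continuous (fun s => w (c - s))}.
  exact: slopes_cont (slopes_omega a al0 al1 bc).
have cp : {within `[a, b], continuous p}.
  apply: derivable_within_continuous => x; rewrite in_itv /= => xab.
  have xc : x < c by lra.
  have H r := is_derive_powR_sub r xc.
  exact: ex_derive.
have IP : Rintegral mu `[a, b] p = P b - P a.
  apply: Rintegral_derive => // x xab.
  have xc : x < c by lra.
  have H r := is_derive_powR_sub r xc.
  apply: is_derive_eq; rewrite /p /GRing.scale /= !addrK.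
  field; lra.
have -> : avg a b (fun s => w (c - s)) - (b - a) / (c - a) * mom a b (fun s => w (c - s)) =
  1 * avg a b (fun s => w (c - s)) + - ((b - a) / (c - a)) * mom a b (fun s => w (c - s)).
  by ring.
rewrite avg_momE // ler_pdivrMl //.
apply: (@le_trans _ _ (Rintegral mu `[a, b] p)).
  apply: le_Rintegral => //.
  - apply: within_integrable; apply: within_continuousM cw.
    exact: continuous_weight.
  - exact: within_integrable.
  - move=> s /=; rewrite in_itv /= => sab.
    rewrite -subr_ge0 /weight /p /omega powRS; last lra.
    set y := (c - s) `^ e; set X := (X in 0 <= X).
    (* The gap between [p] and the weighted kernel factors into terms that are visibly nonnegative
       on the interval. *)
    have -> : X = y / G / (c - a) ^+ 2 * al * ((s - a) * (c - b)).
      by rewrite /X; field; lra.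
    by rewrite !mulr_ge0 ?invr_ge0 ?powR_ge0 ?exprn_ge0 //; lra.
(* The value [- P a] is exactly [(b - a) * (2 / (2 - al)) * w (c - a)], since
   [1 + al / (2 - al) = 2 / (2 - al)]. The remaining [P b] is nonpositive and is dropped. *)
rewrite IP /P subrr oppr0 !mul0r sub0r.
rewrite (powRS (e + 1) ca) (powRS e ca) /omega.
set y := (c - a) `^ e; set z := (c - b) `^ (e + 1 + 1).
rewrite -subr_ge0; set X := (X in 0 <= X).
have -> : X = al * (b - a) / ((c - a) ^+ 2 * (2 - al)) * z / G.
  by rewrite /X; field; lra.
by rewrite !mulr_ge0 ?invr_ge0 ?mulr_ge0 ?powR_ge0 ?exprn_ge0 //; lra.
Qed.

End omega.

(** Cardano's formula: the two cube roots [u] and [v] have product 3, which reduces the cubic to a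
    relation linear in [u ^+ 3] and [v ^+ 3]. Positivity follows from [v > 1]. *)
Lemma Rstar_gt0_cubic : 0 < Rstar R /\ 3 * Rstar R ^+ 2 * (1 + Rstar R) = 1.
Proof.
pose s : R := Num.sqrt 5.
have s0 : 0 <= s by exact: sqrtr_ge0.
have s2 : s ^+ 2 = 5 by rewrite sqr_sqrtr.
have slo : 2 < s by rewrite -(@ltr_pXn2r _ 2) ?nnegrE // s2; lra.
(* The bound 7/3 = 189/81 makes the radicand of [u] nonnegative. *)
have shi : s < 7 / 3 by rewrite -(@ltr_pXn2r _ 2) ?nnegrE ?s2 //; lra.
have cube (x : R) : 0 <= x -> (x `^ (1 / 3)) ^+ 3 = x.
  move=> x0; rewrite -powR_mulrn ?powR_ge0 // -powRrM.
  by rewrite (_ : 1 / 3 * 3%:R = 1) ?powRr1 //; field.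
rewrite /Rstar -/s.
set u := (_ `^ _); set v := ((7 + _) / 2) `^ _.
have u3 : u ^+ 3 = (189 - 81 * s) / 2 by apply: cube; lra.
have v3 : v ^+ 3 = (7 + 3 * s) / 2 by apply: cube; lra.
have u0 : 0 <= u by exact: powR_ge0.
have v0 : 0 <= v by exact: powR_ge0.
have v1 : 1 < v by rewrite -(@ltr_pXn2r _ 3) ?nnegrE // v3; lra.
have uv : u * v = 3.
  have : (u * v) ^+ 3 = 3 ^+ 3.
    rewrite exprMn u3 v3.
    have -> : (189 - 81 * s) / 2 * ((7 + 3 * s) / 2) = (1323 - 243 * s ^+ 2) / 4 by field.
    by rewrite s2; field.
  by move/(pexpIrn (n := 3)); apply=> //; rewrite nnegrE ?mulr_ge0.
split; first lra.
have -> : 3 * (1 / 9 * u + 1 / 3 * v - 1 / 3) ^+ 2 * (1 + (1 / 9 * u + 1 / 3 * v - 1 / 3)) =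
  3 * (u ^+ 3 / 729 + v ^+ 3 / 27 + (u * v) * (u + 3 * v) / 81
     - (u + 3 * v) / 27 + 2 / 27) by field.
rewrite u3 v3 uv; lra.
Qed.

Lemma ge_Rstar (r : R) : Rstar R <= r -> 0 < r /\ 1 <= 3 * r ^+ 2 * (1 + r).
Proof.
have [R0 RE] := Rstar_gt0_cubic => Rr; split; first lra.
have sq : Rstar R ^+ 2 <= r ^+ 2 by rewrite lerXn2r ?nnegrE //; lra.
have sq0 : 0 <= Rstar R ^+ 2 by exact: sqr_ge0.
by rewrite -[leLHS]RE; apply: ler_pM; lra.
Qed.

End power_kernels.

(** * Monotonicity of the discrete kernels *)

Section kernels.
Variable R : realType.
Implicit Types (phi psi h : R -> R) (al : R) (t v : nat -> R).

Section mesh.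
Variable t : nat -> R.
Hypothesis hinc : forall k, t k < t k.+1.
Local Notation r := (stepratio t).

Lemma mesh_lt i j : (i < j)%N -> t i < t j.
Proof. exact: (homo_ltn lt_trans). Qed.

Lemma mesh_le i j : (i <= j)%N -> t i <= t j.
Proof. by rewrite leq_eqVlt => /predU1P[->//|/mesh_lt/ltW]. Qed.

Lemma stepratioE k : r k.+2 = (t k.+2 - t k.+1) / (t k.+1 - t k).
Proof. by []. Qed.

Hypothesis hr : forall k, (2 <= k)%N -> Rstar R <= r k.

Lemma stepratio_gt0 k : 0 < r k.+2.
Proof. by have [] := ge_Rstar (hr (isT : 2 <= k.+2)%N). Qed.

(** The contribution of the interval before the [k]-th one. The value 0 for [k <= 1] absorbs the
    separate formula for the first kernel. *)
Definition prev_term phi k : R :=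
  if (k <= 1)%N then 0
  else mom (t k.-2) (t k.-1) phi / (r k * (1 + r k)).

(** The off-diagonal kernel formula with [omega] replaced by an arbitrary function, so that
    differences of two time levels can be inserted by linearity. *)
Definition inner phi k : R :=
  avg (t k.-1) (t k) phi - mom (t k.-1) (t k) phi / (1 + r k.+1) + prev_term phi k.

(* Separates consecutive kernels: [inner phi k <= barrier phi k < inner phi k.+1]. *)
Definition barrier phi k : R := phi (t k) + prev_term phi k.+1.

Lemma prev_term_ge0 phi h k : slopes phi h (t 0%N) (t k.-1) -> 0 <= prev_term phi k.
Proof.
rewrite /prev_term; case: k => [//|[//|k]] /= S.
have rk := stepratio_gt0 k.
rewrite divr_ge0 //; last by apply: mulr_ge0; lra.
by apply: (mom_ge0 (hinc k) (h := h)); apply: slopesW S => //; exact: mesh_le.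
Qed.

(** The moment is nonnegative, so dividing it by [1 + r k.+2 > 1] only helps and [avg_sub_mom_ge]
    applies. Strictness comes from the positive slope at the left node. *)
Lemma avg_mom_gt phi h k : slopes phi h (t 0%N) (t k.+1) ->
  phi (t k) < avg (t k) (t k.+1) phi - mom (t k) (t k.+1) phi / (1 + r k.+2).
Proof.
move=> S; have tk := hinc k.
have Sk : slopes phi h (t k) (t k.+1) by apply: slopesW S => //; exact: mesh_le.
have H := avg_sub_mom_ge tk Sk; have M := mom_ge0 tk Sk.
have [|_ hk] := slopes_gt0 Sk (x := t k); first by rewrite lexx ltW.
have : 0 < h (t k) * (t k.+1 - t k) by rewrite mulr_gt0 ?subr_gt0.
have rk := stepratio_gt0 k.
have : mom (t k) (t k.+1) phi / (1 + r k.+2) <= mom (t k) (t k.+1) phi.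
  by rewrite ler_pdivrMr ?ler_peMr //; lra.
lra.
Qed.

Lemma barrier_lt_inner phi h k : slopes phi h (t 0%N) (t k.+1) ->
  barrier phi k < inner phi k.+1.
Proof. by move=> S; rewrite /barrier /inner ltrD2r; exact: avg_mom_gt S. Qed.

Lemma inner_gt0 phi h k : slopes phi h (t 0%N) (t k.+1) -> 0 < inner phi k.+1.
Proof.
move=> S; have S' : slopes phi h (t 0%N) (t k) by apply: slopesW S => //; exact: mesh_le.
have [|p _] := slopes_gt0 S (x := t k); first by rewrite !mesh_le.
have := prev_term_ge0 (k := k.+1) S'.
by have := barrier_lt_inner S; rewrite /barrier; lra.
Qed.

(* The slope of [phi] at the common node bounds both the gain on the current
   interval and the correction coming from the previous one; the condition
   [3 r^2 (1 + r) >= 1] is exactly what makes the former win. *)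
Lemma inner_le_barrier phi h k : slopes phi h (t 0%N) (t k.+1) ->
  inner phi k.+1 <= barrier phi k.+1.
Proof.
move=> S; have tk := hinc k.
have Sk : slopes phi h (t k) (t k.+1) by apply: slopesW S => //; exact: mesh_le.
have A := avg_le tk Sk; have M := mom_ge0 tk Sk.
have rk := stepratio_gt0 k.
have B : 0 <= mom (t k) (t k.+1) phi / (1 + r k.+2) by rewrite divr_ge0 //; lra.
have C : 0 <= prev_term phi k.+2 by apply: (prev_term_ge0 (h := h)).
(* The right side is the amount by which [avg_le] places the average below the value at the right
   node. The two moments on the current interval already have the favourable sign. *)
suff : prev_term phi k.+1 <= h (t k) * (t k.+1 - t k) / 2.
  by rewrite /inner /barrier /=; lra.
have [|_ hk] := slopes_gt0 Sk (x := t k); first by rewrite lexx ltW.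
rewrite /prev_term; case: k => [|k] /= in S tk Sk A M rk B C hk *.
  by rewrite divr_ge0 // mulr_ge0 ?subr_ge0 // ltW.
have tk' := hinc k.
have Sk' : slopes phi h (t k) (t k.+1).
  by apply: slopesW S; [exact: mesh_le | exact: ltW].
have M' := mom_le tk' Sk'.
have [r0 r1] := ge_Rstar (hr (isT : 2 <= k.+2)%N).
have -> : t k.+2 - t k.+1 = r k.+2 * (t k.+1 - t k).
  by rewrite stepratioE divfK // subr_eq0 gt_eqF.
have d0 : 0 < t k.+1 - t k by lra.
move: M' r0 r1 d0 hk; set q := r k.+2; set H := h _; set d := _ - _; set m := mom _ _ _.
move=> M' r0 r1 d0 hk.
rewrite ler_pdivrMr; last by apply: mulr_gt0; lra.
apply: (le_trans M'); rewrite -subr_ge0.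
have -> : H * (q * d) / 2 * (q * (1 + q)) - H * d / 6 =
  H * d / 6 * (3 * q ^+ 2 * (1 + q) - 1) by field.
by rewrite mulr_ge0 ?divr_ge0 ?mulr_ge0 //; lra.
Qed.

Lemma prev_termB phi psi k :
  {within `[t 0%N, t k.-1], continuous phi} -> {within `[t 0%N, t k.-1], continuous psi} ->
  prev_term (fun s => phi s - psi s) k = prev_term phi k - prev_term psi k.
Proof.
rewrite /prev_term; case: k => [|[|k]] /= cphi cpsi; rewrite ?subrr //.
have sub : `[t k, t k.+1] `<=` `[t 0%N, t k.+1].
  by move=> x /=; rewrite !in_itv /=; have := mesh_le (leq0n k); lra.
by rewrite momB ?mulrBl //; [exact: continuous_subspaceW cphi|exact: continuous_subspaceW cpsi].
Qed.

Lemma innerB phi psi k :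
  {within `[t 0%N, t k.+1], continuous phi} ->
  {within `[t 0%N, t k.+1], continuous psi} ->
  inner (fun s => phi s - psi s) k.+1 = inner phi k.+1 - inner psi k.+1.
Proof.
move=> cphi cpsi.
have sub : `[t k, t k.+1] `<=` `[t 0%N, t k.+1].
  by move=> x /=; rewrite !in_itv /=; have := mesh_le (leq0n k); lra.
have sub' : `[t 0%N, t k] `<=` `[t 0%N, t k.+1].
  by move=> x /=; rewrite !in_itv /=; have := hinc k; lra.
have c1 := continuous_subspaceW sub cphi; have c2 := continuous_subspaceW sub cpsi.
have c3 := continuous_subspaceW sub' cphi; have c4 := continuous_subspaceW sub' cpsi.
by rewrite /inner /= prev_termB // avgB // momB //; ring.
Qed.

(** * Comparison of consecutive kernels and of consecutive levels *)

Section kernel.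
Variable al : R.
Hypotheses (al0 : 0 < al) (al1 : al < 1).
Local Notation w := (omega (1 - al)).
Local Notation phi n := (fun s => w (t n - s)).

Lemma slopes_kernel n k : (k < n)%N ->
  exists h, slopes (phi n) h (t 0%N) (t k).
Proof. by move=> kn; eexists; apply: slopes_omega => //; exact: mesh_lt. Qed.

Lemma slopes_kernel_diff m n k : (k < m)%N -> (m < n)%N ->
  exists h, slopes (fun s => w (t m - s) - w (t n - s)) h (t 0%N) (t k).
Proof. by move=> km mn; eexists; apply: slopes_omega_diff => //; exact: mesh_lt. Qed.

Lemma Acap_inner n k : (k.+1 < n)%N -> Acap al t n k.+1 = inner (phi n) k.+1.
Proof.
move=> kn; rewrite /Acap /ahat ltn_eqF // leqNgt (leq_ltn_trans _ kn) //=.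
rewrite /inner /prev_term; case: k kn => [|k] kn //=.
by rewrite addr0.
Qed.

(** Doubling the diagonal turns [(1 - al) / (2 - al)] times the exact average [w / (1 - al)] into
    [2 / (2 - al) * w], the constant of [avg_mom_omega_le]. *)
Lemma Acap_diag n : Acap al t n.+2 n.+2 =
  2 / (2 - al) * w (t n.+2 - t n.+1) + 2 * prev_term (phi n.+2) n.+2.
Proof.
rewrite /Acap /ahat eqxx /=.
have -> : akern al t n.+2 n.+2 = w (t n.+2 - t n.+1) / (1 - al).
  by rewrite -avg_omega.
rewrite -[etakern _ _ _ _]/(mom (t n) (t n.+1) (phi n.+2)) /prev_term /=.
have a1 := al1; have rn := stepratio_gt0 n.
by field; rewrite !lt0r_neq0 //; lra.
Qed.

(** Brings level 1, whose kernel has the larger factor [2 / (1 - al)], under the same bound as the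
    later levels. *)
Lemma Acap_diag_ge n : 2 / (2 - al) * w (t n.+1 - t n) + 2 * prev_term (phi n.+1) n.+1
  <= Acap al t n.+1 n.+1.
Proof.
case: n => [|n]; last by rewrite Acap_diag.
rewrite /Acap /ahat /prev_term /= mulr0 addr0.
have -> : akern al t 1 1 = w (t 1%N - t 0%N) / (1 - al) by rewrite -avg_omega.
have w0 : 0 < w (t 1%N - t 0%N) by apply: omega_gt0 => //; rewrite subr_gt0.
have a0 := al0; have a1 := al1.
have : w (t 1%N - t 0%N) / (2 - al) <= w (t 1%N - t 0%N) / (1 - al).
  by rewrite ler_pM2l // lef_pV2 ?posrE; lra.
lra.
Qed.

(** The moment coefficient [1 / (1 + r n.+2)] equals the ratio of the interval length to the
    distance from [t n] to [t n.+2], so [avg_mom_omega_le] fits exactly. *)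
Lemma inner_last_le n : inner (phi n.+2) n.+1 <=
  2 / (2 - al) * w (t n.+2 - t n) + prev_term (phi n.+2) n.+1.
Proof.
rewrite /inner lerD2r /=.
have := avg_mom_omega_le al0 al1 (hinc n) (hinc n.+1).
have -> : (t n.+1 - t n) / (t n.+2 - t n) = (1 + r n.+2)^-1.
  rewrite stepratioE; have := hinc n; have := hinc n.+1 => ? ?.
  by field; lra.
by rewrite [_^-1 * _]mulrC.
Qed.

Lemma two_div_gt1 : 1 < 2 / (2 - al).
Proof. by have := al0; have := al1 => ? ?; rewrite ltr_pdivlMr; lra. Qed.

Lemma Acap_incr_gt0 n k : (k.+1 < n)%N ->
  Acap al t n k.+1 < Acap al t n k.+2 /\ 0 < Acap al t n k.+1.
Proof.
move=> kn; rewrite (Acap_inner kn).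
have [h S] := slopes_kernel kn.
split; last exact: inner_gt0 S.
apply: (le_lt_trans (inner_le_barrier S)).
case: (ltngtP k.+2 n) kn S => // [kn _ _|kn _ S].
  by rewrite (Acap_inner kn); have [h' S'] := slopes_kernel kn; exact: barrier_lt_inner S'.
(* Next to the diagonal the barrier still separates, because [2 / (2 - al) > 1] and the previous
   term is counted twice. *)
rewrite -kn Acap_diag /barrier /=.
rewrite -kn in S; have P := prev_term_ge0 (k := k.+2) S.
have w0 : 0 < w (t k.+2 - t k.+1) by apply: omega_gt0 => //; rewrite subr_gt0.
have : w (t k.+2 - t k.+1) < 2 / (2 - al) * w (t k.+2 - t k.+1).
  by rewrite ltr_pMl // two_div_gt1.
lra.
Qed.

Lemma Acap_decr n k : (k < n)%N -> Acap al t n.+1 k.+1 < Acap al t n k.+1.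
Proof.
move=> kn; rewrite (@Acap_inner n.+1) //.
(* If [k.+1 = n], a diagonal kernel meets an inner one of the next level, and the bounds with the
   common factor [2 / (2 - al)] are compared. Otherwise the difference is [inner] of a convex
   function. *)
move: (kn); rewrite leq_eqVlt => /predU1P[<-|kn'].
  apply: le_lt_trans (inner_last_le k) _.
  apply: lt_le_trans (Acap_diag_ge k).
  have wd : w (t k.+2 - t k) < w (t k.+1 - t k).
    by apply: omega_decr; rewrite ?subr_gt0 // ltrD2r.
  have : 2 / (2 - al) * w (t k.+2 - t k) < 2 / (2 - al) * w (t k.+1 - t k).
    by rewrite ltr_pM2l // (lt_trans _ two_div_gt1).
  have [h1 S1] := slopes_kernel (ltnSn k).
  have [h2 S2] := slopes_kernel (ltnW (ltnSn k.+1)).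
  have [h3 S3] := slopes_kernel_diff (ltnSn k) (ltnSn k.+1).
  have := prev_term_ge0 (k := k.+1) S1.
  have := prev_term_ge0 (k := k.+1) S3.
  rewrite prev_termB; [|exact: slopes_cont S1|exact: slopes_cont S2].
  clear; move: (prev_term _ _) (prev_term _ _) => x y; move: (_ * w _) (_ * w _) => p q.
  lra.
rewrite (Acap_inner kn') -subr_gt0.
have [h1 S1] := slopes_kernel kn'.
have [h2 S2] := slopes_kernel (ltnW kn' : k.+1 < n.+1)%N.
have [h3 S3] := slopes_kernel_diff kn' (ltnSn n).
rewrite -innerB; [|exact: slopes_cont S1|exact: slopes_cont S2].
exact: inner_gt0 S3.
Qed.

(** Rearranged, the drop from level [n] to level [n.+1] must increase with the index. Off the
    diagonal that drop is [inner] of the kernel difference, whose barrier separates consecutive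
    values. *)
Lemma Acap_diff_decr n k : (k.+1 < n)%N ->
  Acap al t n.+1 k.+2 - Acap al t n.+1 k.+1 < Acap al t n k.+2 - Acap al t n k.+1.
Proof.
move=> kn; rewrite (Acap_inner kn) !(@Acap_inner n.+1) //; last exact: ltnW.
have [h1 S1] := slopes_kernel kn.
have [h2 S2] := slopes_kernel (ltnW kn : k.+1 < n.+1)%N.
have [h3 S3] := slopes_kernel_diff kn (ltnSn n).
have := inner_le_barrier S3.
rewrite innerB; [|exact: slopes_cont S1|exact: slopes_cont S2].
case: (ltngtP k.+2 n) (kn) => // [kn' _|kn' _].
  rewrite (Acap_inner kn').
  have [h4 S4] := slopes_kernel kn'.
  have [h5 S5] := slopes_kernel (ltnW kn' : k.+2 < n.+1)%N.
  have [h6 S6] := slopes_kernel_diff kn' (ltnSn n).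
  have := barrier_lt_inner S6.
  rewrite innerB; [|exact: slopes_cont S4|exact: slopes_cont S5].
  clear; move: (barrier _ _) (inner _ k.+2) (inner _ k.+2).
  move: (inner _ k.+1) (inner _ k.+1) => x y b z u; lra.
(* Diagonal case [k.+2 = n]: the bounds leave a surplus of [2 / (2 - al) - 1] times a positive
   difference of [w], plus one nonnegative previous term. *)
rewrite /barrier prev_termB; [|exact: slopes_cont S1|exact: slopes_cont S2].
move: S1 S2 S3; rewrite -kn' => S1 S2 S3.
have := inner_last_le k.+1; rewrite Acap_diag.
have := prev_term_ge0 (k := k.+2) S1.
have wd : w (t k.+3 - t k.+1) < w (t k.+2 - t k.+1).
  by apply: omega_decr; rewrite ?subr_gt0 // ltrD2r.
have : 0 < (2 / (2 - al) - 1) * (w (t k.+2 - t k.+1) - w (t k.+3 - t k.+1)).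
  by rewrite mulr_gt0 // subr_gt0 // two_div_gt1.
clear; move: (w _) (w _) (2 / _) => x y c.
move: (inner _ k.+2) (prev_term _ _) (prev_term _ _) => z p q.
move: (inner _ _) (inner _ _) => u1 u2. lra.
Qed.

End kernel.
End mesh.

(** * Summation by parts and the energy identity *)

Lemma sum_nablav v j n : (j <= n)%N -> \sum_(j.+1 <= l < n.+1) nablav v l = v n - v j.
Proof. by move=> jn; rewrite big_add1 /= telescope_sumr. Qed.

(** Abel summation with a free reference value [c], which the induction needs; taking [c] to be the
    last value of [v] removes the boundary term. *)
Lemma sum_mul_nablav (A v : nat -> R) (c : R) m :
  \sum_(1 <= k < m.+2) A k * nablav v k =
  A 1%N * (c - v 0%N) + \sum_(1 <= j < m.+1) (A j.+1 - A j) * (c - v j)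
  - A m.+1 * (c - v m.+1).
Proof.
elim: m => [|m IH]; first by rewrite big_nat1 big_geq // /nablav /=; ring.
rewrite big_nat_recr //= IH [in RHS]big_nat_recr //= /nablav /=; ring.
Qed.

(** The squares of the last increment carry coefficients that telescope to [A m.+2 / 2], precisely
    the term subtracted on the left, so an equality results. *)
Lemma nablav_energy (A v : nat -> R) m :
  nablav v m.+2 * (\sum_(1 <= k < m.+3) A k * nablav v k - A m.+2 / 2 * nablav v m.+2) =
  1 / 2 * (\sum_(1 <= j < m.+2) (A j.+1 - A j) * (v m.+2 - v j) ^+ 2
            + A 1%N * (v m.+2 - v 0%N) ^+ 2)
  - 1 / 2 * (\sum_(1 <= j < m.+1) (A j.+1 - A j) * (v m.+1 - v j) ^+ 2
            + A 1%N * (v m.+1 - v 0%N) ^+ 2).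
Proof.
rewrite (sum_mul_nablav A v (v m.+2)) subrr mulr0 subr0.
(* The extra index [j = m.+1] contributes zero and gives all sums the same range. *)
have -> : \sum_(1 <= j < m.+1) (A j.+1 - A j) * (v m.+1 - v j) ^+ 2 =
    \sum_(1 <= j < m.+2) (A j.+1 - A j) * (v m.+1 - v j) ^+ 2.
  by rewrite [RHS]big_nat_recr //= subrr expr0n mulr0 addr0.
have E : nablav v m.+2 * \sum_(1 <= j < m.+2) (A j.+1 - A j) * (v m.+2 - v j) =
    1 / 2 * \sum_(1 <= j < m.+2) (A j.+1 - A j) * (v m.+2 - v j) ^+ 2
    - 1 / 2 * \sum_(1 <= j < m.+2) (A j.+1 - A j) * (v m.+1 - v j) ^+ 2
    + nablav v m.+2 ^+ 2 / 2 * \sum_(1 <= j < m.+2) (A j.+1 - A j).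
  rewrite !mulr_sumr -sumrB -big_split /=; apply: eq_bigr => j _.
  by rewrite /nablav /=; field.
rewrite telescope_sumr // in E.
rewrite mulrBr mulrDr E /nablav /=; by field.
Qed.

End kernels.

Theorem theorem2p1 (R : realType) (al : R) (t : nat -> R)
  (hal0 : 0 < al) (hal1 : al < 1)
  (ht0 : t 0%N = 0) (hinc : forall k : nat, t k < t k.+1)
  (hr : forall k : nat, (2 <= k)%N -> Rstar R <= stepratio t k) :
  (* (a) *)
  (forall n k : nat, (2 <= n)%N -> (1 <= k)%N -> (k <= n - 1)%N ->
      Acap al t n k.+1 > Acap al t n k /\ Acap al t n k > 0) /\
  (* (b) *)
  (forall n k : nat, (2 <= n)%N -> (1 <= k)%N -> (k <= n - 1)%N ->
      Acap al t n.-1 k > Acap al t n k) /\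
  (* (c) *)
  (forall n k : nat, (3 <= n)%N -> (1 <= k)%N -> (k <= n - 2)%N ->
      Acap al t n.-1 k.+1 - Acap al t n.-1 k > Acap al t n k.+1 - Acap al t n k) /\
  (* energy inequality *)
  (forall (v : nat -> R) (n : nat), (2 <= n)%N ->
     nablav v n * (\sum_(1 <= k < n.+1) ahat al t n k * nablav v k) >=
       1 / 2 * (\sum_(1 <= j < n) (Acap al t n j.+1 - Acap al t n j)
                   * (\sum_(j.+1 <= l < n.+1) nablav v l) ^+ 2
                + Acap al t n 1 * (\sum_(1 <= l < n.+1) nablav v l) ^+ 2)
     - 1 / 2 * (\sum_(1 <= j < n.-1) (Acap al t n.-1 j.+1 - Acap al t n.-1 j)
                   * (\sum_(j.+1 <= l < n) nablav v l) ^+ 2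
                + Acap al t n.-1 1 * (\sum_(1 <= l < n) nablav v l) ^+ 2)).
Proof.
split=> [[|[|n]] [|k] // _ _|]; first by rewrite subn1 => kn; exact: Acap_incr_gt0.
split=> [[|[|n]] [|k] // _ _|]; first by rewrite subn1 => kn; exact: Acap_decr.
split=> [[|[|[|n]]] [|k] // _ _|].
  by rewrite subn2 => kn; exact: Acap_diff_decr.
move=> v [|[|m]] //= _.
rewrite (sum_nablav v (leq0n m.+2)) (sum_nablav v (leq0n m.+1)).
(* The two kernels differ only on the diagonal, where [ahat] is half of [Acap]; this half is the
   correction term of [nablav_energy]. *)
have -> : \sum_(1 <= k < m.+3) ahat al t m.+2 k * nablav v k =
  \sum_(1 <= k < m.+3) Acap al t m.+2 k * nablav v k - Acap al t m.+2 m.+2 / 2 * nablav v m.+2.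
  rewrite big_nat_recr // [in RHS]big_nat_recr //= {2 3}/Acap eqxx.
  rewrite (_ : \sum_(1 <= k < m.+2) Acap al t m.+2 k * nablav v k =
      \sum_(1 <= k < m.+2) ahat al t m.+2 k * nablav v k); first by field.
  by apply: eq_big_nat => k /andP[_ km]; rewrite /Acap ltn_eqF.
rewrite nablav_energy.
under eq_big_nat => j /andP[_ jm] do rewrite sum_nablav ?(ltnW jm) //.
apply: lerB; first exact: lexx.
apply: ler_wpM2l; first exact: divr_ge0.
(* Only the second bracket differs: the sum is compared termwise by (c), the last square by (b) at
   index 1. *)
apply: lerD.
  rewrite !big_nat; apply: ler_sum => j /andP[j0 jm].
  rewrite sum_nablav; last exact: ltnW.
  apply: ler_wpM2r; first exact: sqr_ge0.
  move: jm; rewrite -(prednK j0) => jm.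
  exact: ltW (Acap_diff_decr hinc hr hal0 hal1 jm).
apply: ler_wpM2r; first exact: sqr_ge0.
exact: ltW (Acap_decr hinc hr hal0 hal1 (ltn0Sn m)).
Qed.
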